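(* Let $A\to B\to C$ be a sequence of ring homomorphisms, and let $m\in\mathbb N\cup\{\infty\}$. Then the sequence $$0 \to \bigl(\mathrm{HS}^m_{B/A}\bigr)^{+}\,\mathrm{HS}^m_{C/A} \to \mathrm{HS}^m_{C/A} \to \mathrm{HS}^m_{C/B} \to 0$$ is an exact sequence of graded $C$-algebras, where $(\mathrm{HS}^m_{B/A})^{+}$ denotes the ideal of elements of degree $>0$ in the graded algebra $\mathrm{HS}^m_{B/A}$.
   Context: All rings and algebras are commutative with $1$; $\mathbb N$ contains $0$; when $m=\infty$, ''$i=1,\dots,m$'' means all positive integers $i$ (and ''$i=0,\dots,m$'' all $i\ge 0$). For a ring homomorphism $f\colon A\to B$, $\mathrm{HS}^m_{B/A}$ is the quotient of the polynomial algebra $B[x^{(i)}]_{x\in B,\ i=1,\dots,m}$ by the ideal generated by: $(x+y)^{(i)}-x^{(i)}-y^{(i)}$ for $x,y\in B$, $i=1,\dots,m$; $f(a)^{(i)}$ for $a\in A$, $i=1,\dots,m$; and $(xy)^{(k)}-\sum_{i+j=k}x^{(i)}y^{(j)}$ for $x,y\in B$, $k=0,\dots,m$, where $x^{(0)}$ is identified with $x$. Write $d_i x$ for the class of $x^{(i)}$ (so $d_0x=x$). $\mathrm{HS}^m_{B/A}$ is a graded $B$-algebra with $B$ in degree $0$ and $d_ix$ of degree $i$. The natural map $\mathrm{HS}^m_{B/A}\to\mathrm{HS}^m_{C/A}$ sends $d_ib$ to $d_i$ of the image of $b$ in $C$; $(\mathrm{HS}^m_{B/A})^{+}\,\mathrm{HS}^m_{C/A}$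 is the ideal of $\mathrm{HS}^m_{C/A}$ generated by the image of $(\mathrm{HS}^m_{B/A})^{+}$ (the left-hand term of the sequence is this ideal, i.e. a non-unital algebra, and the first map is inclusion). The map $\mathrm{HS}^m_{C/A}\to\mathrm{HS}^m_{C/B}$ is the $C$-algebra map sending $d_ic$ to $d_ic$. *)

(* Defs.v *)
(* Rings are comPzRingType, so that the zero ring is allowed; the polynomial    *)
(* algebras and ring quotients of the libraries require 1 != 0 and are          *)
(* therefore redone here without that restriction.                              *)
From HB Require Import structures.
From mathcomp Require Import all_boot all_order all_algebra.
From mathcomp Require Import generic_quotient ring_quotient.
From mathcomp Require Import finmap boolp.
From mathcomp.multinomials Require Import xfinmap monalg.

Set Implicit Arguments.
Unset Strict Implicit.
Unset Printing Implicit Defensive.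

Import GRing.Theory BigEnoughFSet.

Local Open Scope fset_scope.
Local Open Scope ring_scope.
Local Open Scope quotient_scope.

(* The polynomial algebra R[V]: finitely supported functions from monomials   *)
(* to R, with the convolution product.                                        *)
Definition polyalg (R : comPzRingType) (V : choiceType) :=
  {malg R[{cmonom V}]}.

HB.instance Definition _ (R : comPzRingType) (V : choiceType) :=
  GRing.Zmodule.copy (polyalg R V) {malg R[{cmonom V}]}.

HB.lock
Definition pa_mul (R : comPzRingType) (V : choiceType)
    (g1 g2 : {malg R[{cmonom V}]}) : {malg R[{cmonom V}]} :=
  \sum_(k1 <- msupp g1) \sum_(k2 <- msupp g2)
    << g1@_k1 * g2@_k2 *g mmul k1 k2 >>.

HB.lock
Definition pa_const (R : comPzRingType) (V : choiceType) (c : R) :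
  polyalg R V := << c *g mone >>.

HB.lock
Definition pa_var (R : comPzRingType) (V : choiceType) (v : V) :
  polyalg R V := << 1 *g ucm v >>.

Arguments pa_const {R} V c.
Arguments pa_var R {V} v.

Section PolyAlgRing.
Variables (R : comPzRingType) (V : choiceType).

Local Notation K := {cmonom V}.
Local Notation P := {malg R[K]}.

Implicit Types (g : P) (k : K).

Local Notation "g1 *M_[ k1 , k2 ] g2" :=
  << g1@_k1%M * g2@_k2%M *g (mmul k1 k2) >>
  (at level 40, no associativity).

Local Notation pa_mul := (@pa_mul R V).
Local Notation pa_const := (@pa_const R V).

Lemma pa_mulE g1 g2 : pa_mul g1 g2 =
  \sum_(k1 <- msupp g1) \sum_(k2 <- msupp g2) g1 *M_[k1, k2] g2.
Proof. by rewrite pa_mul.unlock. Qed.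

Definition pa_one : P := << 1 *g mone >>.

Lemma pa_mullw (d1 d2 : {fset K}) g1 g2 :
  msupp g1 `<=` d1 -> msupp g2 `<=` d2 ->
  pa_mul g1 g2 = \sum_(k1 <- d1) \sum_(k2 <- d2) g1 *M_[k1, k2] g2.
Proof.
move=> le_d1 le_d2; rewrite pa_mulE (big_fset_incl _ le_d1) /=.
  apply/eq_bigr=> k1 _; apply/big_fset_incl => // k _ /mcoeff_outdom ->.
  by rewrite mulr0 monalgU0.
move=> k _ /mcoeff_outdom g1k.
by rewrite big1 => // k' _; rewrite g1k mul0r monalgU0.
Qed.

Lemma pa_mulC : commutative pa_mul.
Proof.
move=> g1 g2; rewrite !pa_mulE exchange_big /=.
apply/eq_bigr=> k1 _; apply/eq_bigr=> k2 _.
by rewrite mulrC (mulmC k2).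
Qed.

Lemma pa_mul0g : left_zero 0 pa_mul.
Proof. by move=> g; rewrite pa_mulE msupp0 big_seq_fset0. Qed.

Lemma pa_mulg0 : right_zero 0 pa_mul.
Proof. by move=> g; rewrite pa_mulC pa_mul0g. Qed.

Lemma pa_mulUU c1 c2 k1 k2 :
  pa_mul << c1 *g k1 >> << c2 *g k2 >> = << c1 * c2 *g mmul k1 k2 >>.
Proof. by rewrite (pa_mullw msuppU_le msuppU_le) !big_seq_fset1 !mcoeffUU. Qed.

Lemma pa_mulUg c k g :
  pa_mul << c *g k >> g = \sum_(k' <- msupp g) << c * g@_k' *g mmul k k' >>.
Proof.
rewrite (pa_mullw msuppU_le (fsubset_refl _)) big_seq_fset1.
by apply/eq_bigr => k' _; rewrite mcoeffUU.
Qed.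

Lemma pa_mul1g : left_id pa_one pa_mul.
Proof.
move=> g; rewrite pa_mulUg [RHS]monalgE.
by apply/eq_bigr=> kg _; rewrite mul1r mul1m.
Qed.

Lemma pa_mulDl : left_distributive pa_mul +%R.
Proof.
move=> g1 g2 g; have le2 := fsubset_refl (msupp g).
rewrite (pa_mullw (msuppD_le _ _) le2).
rewrite (pa_mullw (fsubsetUl (msupp g1) (msupp g2)) le2).
rewrite (pa_mullw (fsubsetUr (msupp g1) (msupp g2)) le2).
rewrite -big_split /=; apply/eq_bigr=> k1 _.
rewrite -big_split /=; apply/eq_bigr=> k2 _.
by rewrite mcoeffD mulrDl monalgUD.
Qed.

Lemma pa_mulDr : right_distributive pa_mul +%R.
Proof. by move=> g g1 g2; rewrite !(pa_mulC g) pa_mulDl. Qed.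

Lemma pa_mulEl g1 g2 :
  pa_mul g1 g2 = \sum_(k1 <- msupp g1) pa_mul << g1@_k1 *g k1 >> g2.
Proof. by rewrite pa_mulE; apply/eq_bigr=> k _; rewrite pa_mulUg. Qed.

Lemma pa_mulEr g1 g2 :
  pa_mul g1 g2 = \sum_(k2 <- msupp g2) pa_mul g1 << g2@_k2 *g k2 >>.
Proof. by rewrite pa_mulC pa_mulEl; apply/eq_bigr=> k _; rewrite pa_mulC. Qed.

Lemma pa_mulA : associative pa_mul.
Proof.
move=> g1 g2 g3.
have suml I r (F : I -> P) g :
    pa_mul (\sum_(i <- r) F i) g = \sum_(i <- r) pa_mul (F i) g.
  by apply: (big_morph (pa_mul^~ g) (fun _ _ => pa_mulDl _ _ _) (pa_mul0g _)).
have sumr I r (F : I -> P) g :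
    pa_mul g (\sum_(i <- r) F i) = \sum_(i <- r) pa_mul g (F i).
  by apply: (big_morph (pa_mul g) (fun _ _ => pa_mulDr _ _ _) (pa_mulg0 _)).
have mulUg U c k : pa_mul U (pa_mul << c *g k >> g3) =
    \sum_(k' <- msupp g3) pa_mul U << c * g3@_k' *g mmul k k' >>.
  by rewrite pa_mulUg sumr.
rewrite [LHS]pa_mulEl (pa_mulEl g1 g2) [RHS]suml; apply/eq_bigr=> k1 _.
rewrite (pa_mulEl g2 g3) [LHS]sumr.
rewrite [X in pa_mul X g3]pa_mulEr [RHS]suml; apply/eq_bigr=> k2 _.
apply: etrans (mulUg _ _ _) _; apply/esym.
apply: etrans (congr1 (pa_mul^~ g3) (pa_mulUU _ _ _ _)) _.
apply: etrans (pa_mulUg _ _ _) _; apply/eq_bigr=> k3 _.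
by apply/esym/(etrans (pa_mulUU _ _ _ _)); rewrite mulrA mulmA.
Qed.

HB.instance Definition _ := GRing.Zmodule_isComPzRing.Build (polyalg R V)
  pa_mulA pa_mulC pa_mul1g pa_mulDl.

Lemma pa_const_zmod_morphism : zmod_morphism pa_const.
Proof. by move=> x y; rewrite pa_const.unlock monalgUB. Qed.

Lemma pa_const_monoid_morphism : monoid_morphism pa_const.
Proof.
by rewrite pa_const.unlock; split=> // x y; rewrite [RHS]pa_mulUU mul1m.
Qed.

HB.instance Definition _ := GRing.isZmodMorphism.Build R (polyalg R V) pa_const
  pa_const_zmod_morphism.
HB.instance Definition _ := GRing.isMonoidMorphism.Build R (polyalg R V)
  pa_const pa_const_monoid_morphism.

End PolyAlgRing.

(* The evaluation morphism R[V] -> S that extends f and sends v to h v.       *)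
HB.lock
Definition pa_eval (R S : comPzRingType) (V : choiceType) (f : R -> S)
    (h : V -> S) (p : polyalg R V) : S :=
  \sum_(m <- msupp p) f p@_m * \prod_(v <- finsupp m) h v ^+ m v.

Section PolyAlgEval.
Variables (R S : comPzRingType) (V : choiceType).
Variables (f : {rmorphism R -> S}) (h : V -> S).

Definition pa_mev (m : {cmonom V}) : S := \prod_(v <- finsupp m) h v ^+ m v.

Local Notation pa_eval := (@pa_eval R S V f h).

Lemma pa_evalE p : pa_eval p = \sum_(m <- msupp p) f p@_m * pa_mev m.
Proof. by rewrite pa_eval.unlock. Qed.

Lemma pa_mevEw (m : {cmonom V}) (d : {fset V}) : finsupp m `<=` d ->
  pa_mev m = \prod_(v <- d) h v ^+ m v.
Proof.
move=> le; rewrite /pa_mev (big_fset_incl _ le) //= => v _.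
by rewrite -cmE_eq0 => /eqP ->; rewrite expr0.
Qed.

Lemma pa_mev1 : pa_mev mone = 1.
Proof. by rewrite /pa_mev mdom1 big_seq_fset0. Qed.

Lemma pa_mevM : {morph pa_mev : m1 m2 / mmul m1 m2 >-> m1 * m2}.
Proof.
move=> m1 m2; rewrite {1}/pa_mev mdomD.
rewrite (pa_mevEw (fsubsetUl _ (finsupp m2))).
rewrite (pa_mevEw (fsubsetUr (finsupp m1) _)) -big_split /=.
by apply/eq_bigr=> v _; rewrite cmM exprD.
Qed.

Lemma pa_mevU v : pa_mev (ucm v) = h v.
Proof. by rewrite /pa_mev mdomU big_seq_fset1 cmUU expr1. Qed.

Lemma pa_evalEw (d : {fset {cmonom V}}) (p : polyalg R V) :
  msupp p `<=` d -> pa_eval p = \sum_(m <- d) f p@_m * pa_mev m.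
Proof.
move=> le; rewrite pa_evalE (big_fset_incl _ le) => //= x xd /mcoeff_outdom ->.
by rewrite raddf0 mul0r.
Qed.

Lemma pa_evalU c m : pa_eval << c *g m >> = f c * pa_mev m.
Proof. by rewrite (pa_evalEw msuppU_le) big_seq_fset1 mcoeffUU. Qed.

Lemma pa_eval_zmod_morphism : zmod_morphism pa_eval.
Proof.
move=> g1 g2; pose_big_fset {cmonom V} E; rewrite 3?(pa_evalEw (d := E)) //.
  by rewrite -sumrB; apply/eq_bigr=> k _; rewrite mcoeffB raddfB /= mulrBl.
by close.
Qed.

HB.instance Definition _ := GRing.isZmodMorphism.Build (polyalg R V) S pa_eval
  pa_eval_zmod_morphism.

Lemma pa_eval_monoid_morphism : monoid_morphism pa_eval.
Proof.
split=> [|g1 g2]; first by rewrite pa_evalU rmorph1 pa_mev1 mulr1.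
rewrite [in LHS]/GRing.mul /= pa_mulE.
rewrite (raddf_sum pa_eval) (pa_evalE g1) mulr_suml; apply: eq_bigr=> i _.
rewrite (raddf_sum pa_eval) (pa_evalE g2) mulr_sumr; apply: eq_bigr=> j _.
by rewrite /= pa_evalU rmorphM pa_mevM mulrACA.
Qed.

HB.instance Definition _ := GRing.isMonoidMorphism.Build (polyalg R V) S pa_eval
  pa_eval_monoid_morphism.

Lemma pa_eval_const c : pa_eval (pa_const V c) = f c.
Proof. by rewrite pa_const.unlock pa_evalU pa_mev1 mulr1. Qed.

Lemma pa_eval_var v : pa_eval (pa_var R v) = h v.
Proof. by rewrite pa_var.unlock pa_evalU rmorph1 pa_mevU mul1r. Qed.

End PolyAlgEval.

Section IdealQuotient.
Variables (R : comPzRingType) (S : R -> Prop).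

Definition ideal_closed (T : comPzRingType) (I : T -> Prop) :=
  [/\ I 0, (forall x y, I x -> I y -> I (x + y))
    & forall a x, I x -> I (a * x)].

Definition gen_ideal : {pred R} := fun x =>
  `[< forall I : R -> Prop,
        ideal_closed I -> (forall s, S s -> I s) -> I x >].

Lemma gen_idealP x :
  reflect (forall I : R -> Prop,
             ideal_closed I -> (forall s, S s -> I s) -> I x)
          (x \in gen_ideal).
Proof. exact: asboolP. Qed.

Lemma gen_ideal_gen s : S s -> s \in gen_ideal.
Proof. by move=> Ss; apply/gen_idealP => I _ /(_ s Ss). Qed.

Lemma gen_idealMl a x : x \in gen_ideal -> a * x \in gen_ideal.
Proof.
by move/gen_idealP=> Ix; apply/gen_idealP=> I hI hS; case: (hI) => _ _; apply;
   apply: Ix.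
Qed.

Lemma gen_ideal_zmod_closed : zmod_closed gen_ideal.
Proof.
split=> [|x y /gen_idealP Ix /gen_idealP Iy].
  by apply/gen_idealP => I [].
apply/gen_idealP => I hI hS; case: (hI) => _ hD hM; apply: hD.
  exact: Ix.
by rewrite -mulN1r; apply: hM; apply: Iy.
Qed.

HB.instance Definition _ := GRing.isZmodClosed.Build R gen_ideal
  gen_ideal_zmod_closed.

Definition quot_ring := Quotient.quot gen_ideal.

HB.instance Definition _ := GRing.Zmodule.on quot_ring.
HB.instance Definition _ : EqQuotient R (Quotient.equiv gen_ideal) quot_ring :=
  EqQuotient.on quot_ring.

Definition quot_pi (x : R) : quot_ring := \pi_quot_ring x.

Lemma quot_piP x y : reflect (quot_pi x = quot_pi y) (x - y \in gen_ideal).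
Proof. by rewrite (Quotient.idealrBE gen_ideal); apply: eqP. Qed.

Lemma quot_reprK (x : quot_ring) : quot_pi (repr x) = x.
Proof. exact: reprK. Qed.

Lemma quot_pi_zmod_morphism : zmod_morphism quot_pi.
Proof. exact: (raddfB \pi_(Quotient.quot gen_ideal)). Qed.

HB.instance Definition _ := GRing.isZmodMorphism.Build R quot_ring quot_pi
  quot_pi_zmod_morphism.

Definition quot_mul (x y : quot_ring) : quot_ring := quot_pi (repr x * repr y).

Lemma quot_piM x y : quot_pi (x * y) = quot_mul (quot_pi x) (quot_pi y).
Proof.
apply/quot_piP.
set x' := repr (quot_pi x); set y' := repr (quot_pi y).
have Ix : x - x' \in gen_ideal by apply/quot_piP; rewrite quot_reprK.
have Iy : y - y' \in gen_ideal by apply/quot_piP; rewrite quot_reprK.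
have -> : x * y - x' * y' = y * (x - x') + x' * (y - y').
  by rewrite !mulrBr (mulrC y x') (mulrC y x) addrA subrK.
by rewrite rpredD // gen_idealMl.
Qed.

Lemma quot_mulA : associative quot_mul.
Proof.
by move=> x y z; rewrite -[x]quot_reprK -[y]quot_reprK -[z]quot_reprK;
   rewrite -!quot_piM mulrA.
Qed.

Lemma quot_mulC : commutative quot_mul.
Proof. by move=> x y; rewrite /quot_mul mulrC. Qed.

Lemma quot_mul1 : left_id (quot_pi 1) quot_mul.
Proof. by move=> x; rewrite -[x]quot_reprK -quot_piM mul1r. Qed.

Lemma quot_mulDl : left_distributive quot_mul +%R.
Proof.
move=> x y z; rewrite -[x]quot_reprK -[y]quot_reprK -[z]quot_reprK.
by rewrite -raddfD -!quot_piM -raddfD mulrDl.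
Qed.

HB.instance Definition _ := GRing.Zmodule_isComPzRing.Build quot_ring
  quot_mulA quot_mulC quot_mul1 quot_mulDl.

Lemma quot_pi_monoid_morphism : monoid_morphism quot_pi.
Proof. by split=> // x y; apply: quot_piM. Qed.

HB.instance Definition _ := GRing.isMonoidMorphism.Build R quot_ring quot_pi
  quot_pi_monoid_morphism.

Definition quot_lift (T : comPzRingType) (phi : R -> T) (x : quot_ring) : T :=
  phi (repr x).

Lemma quot_liftE (T : comPzRingType) (phi : {rmorphism R -> T}) :
  (forall s, S s -> phi s = 0) ->
  forall x, quot_lift phi (quot_pi x) = phi x.
Proof.
move=> phiS x; apply/eqP; rewrite -subr_eq0 -rmorphB; apply/eqP.
have : repr (quot_pi x) - x \in gen_ideal by apply/quot_piP/quot_reprK.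
move/gen_idealP/(_ (fun z => phi z = 0)); apply=> //; split=> [|u v pu pv|a u pu].
- exact: rmorph0.
- by rewrite rmorphD pu pv addr0.
- by rewrite rmorphM pu mulr0.
Qed.

End IdealQuotient.

(* An order m in N u {oo}; None stands for oo.                                *)
Definition le_ord (i : nat) (m : option nat) : bool :=
  if m is Some n then (i <= n)%N else true.

Definition hs_index (m : option nat) := {i : nat | (0 < i)%N && le_ord i m}.

Definition hs_poly (B : comPzRingType) (m : option nat) :=
  polyalg B (B * hs_index m)%type.
HB.instance Definition _ (B : comPzRingType) (m : option nat) :=
  GRing.ComPzRing.on (hs_poly B m).

(* x^(i), with x^(0) = x; the value for i > m is a dummy.                     *)
HB.lock
Definition hs_gen (B : comPzRingType) (m : option nat) (x : B) (i : nat) :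
    hs_poly B m :=
  if i is 0 then pa_const _ x
  else if insub i is Some j then pa_var B (x, j) else 0.

Section HasseSchmidt.
Variables (A B : comPzRingType) (f : {rmorphism A -> B}) (m : option nat).

Local Notation hs_poly := (hs_poly B m).
Local Notation hs_gen := (@hs_gen B m).

Inductive hs_rel : hs_poly -> Prop :=
| HsAdd x y i of (0 < i)%N & le_ord i m :
    hs_rel (hs_gen (x + y) i - hs_gen x i - hs_gen y i)
| HsBase a i of (0 < i)%N & le_ord i m :
    hs_rel (hs_gen (f a) i)
| HsMul x y k of le_ord k m :
    hs_rel (hs_gen (x * y) k - \sum_(i < k.+1) hs_gen x i * hs_gen y (k - i)).

Definition HS := quot_ring hs_rel.
HB.instance Definition _ := GRing.ComPzRing.on HS.

Definition hs_pi : {rmorphism hs_poly -> HS} := @quot_pi hs_poly hs_rel.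

Definition hs_const (b : B) : HS := hs_pi (pa_const _ b).
HB.instance Definition _ :=
  GRing.RMorphism.copy hs_const (hs_pi \o @pa_const B (B * hs_index m)%type).

Definition hs_d (i : nat) (x : B) : HS := hs_pi (hs_gen x i).

Definition hs_scale (b : B) (h : HS) : HS := hs_const b * h.

Lemma hs_scaleA a b v : hs_scale a (hs_scale b v) = hs_scale (a * b) v.
Proof. by rewrite /hs_scale rmorphM mulrA. Qed.

Lemma hs_scale1 : left_id 1 hs_scale.
Proof. by move=> v; rewrite /hs_scale rmorph1 mul1r. Qed.

Lemma hs_scaleDr : right_distributive hs_scale +%R.
Proof. by move=> a u v; rewrite /hs_scale mulrDr. Qed.

Lemma hs_scaleDl v : {morph hs_scale^~ v : a b / a + b}.
Proof. by move=> a b; rewrite /hs_scale rmorphD mulrDl. Qed.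

HB.instance Definition _ := GRing.Zmodule_isLmodule.Build B HS
  hs_scaleA hs_scale1 hs_scaleDr hs_scaleDl.

(* The grading is induced by giving x^(i) weight i and elements of B weight 0. *)
Definition hs_weight (mon : {cmonom (B * hs_index m)%type}) : nat :=
  (\sum_(v <- finsupp mon) mon v * val v.2)%N.

Definition hs_homog (n : nat) (p : hs_poly) : Prop :=
  forall mon, mon \in msupp p -> hs_weight mon = n.

Definition hs_deg (n : nat) (h : HS) : Prop :=
  exists2 p : hs_poly, hs_homog n p & h = hs_pi p.

(* The sum of the components of degree > 0.                                    *)
Definition hs_plus (h : HS) : Prop :=
  exists k (u : nat -> HS),
    (forall i, hs_deg i.+1 (u i)) /\ h = \sum_(i < k) u i.

End HasseSchmidt.

Arguments hs_const {A B} f m b.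
Arguments hs_d {A B} f m i x.
Arguments hs_plus {A B} f m h.

(* The ring morphism d_i x |-> d_i (beta x) attached to a commutative square  *)
(* beta \o f = f' \o alpha.                                                   *)
Section Functoriality.
Variables (A B A' B' : comPzRingType).
Variables (f : {rmorphism A -> B}) (f' : {rmorphism A' -> B'}).
Variables (alpha : {rmorphism A -> A'}) (beta : {rmorphism B -> B'}).
Hypothesis sq : forall a, beta (f a) = f' (alpha a).
Variable m : option nat.

Definition hs_map_poly : hs_poly B m -> HS f' m :=
  pa_eval (hs_const f' m \o beta)
          (fun v : B * hs_index m => hs_d f' m (val v.2) (beta v.1)).
HB.instance Definition _ := GRing.RMorphism.on hs_map_poly.

(* The proof argument is what makes hs_map a ring morphism.                    *)
Definition hs_map of (forall a, beta (f a) = f' (alpha a)) :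
    HS f m -> HS f' m :=
  quot_lift hs_map_poly.

Lemma hs_map_gen x i : le_ord i m ->
  hs_map_poly (hs_gen m x i) = hs_d f' m i (beta x).
Proof.
rewrite hs_gen.unlock; case: i => [|i] im.
  by rewrite /hs_d hs_gen.unlock; apply: pa_eval_const.
case: insubP => [j _ ji|]; last by rewrite im.
by rewrite /hs_map_poly pa_eval_var ji.
Qed.

Lemma hs_piI (p : hs_poly B' m) : hs_rel f' p -> hs_pi f' m p = 0.
Proof.
move=> rp; rewrite -(rmorph0 (hs_pi f' m)); apply/quot_piP.
by rewrite subr0; apply: gen_ideal_gen.
Qed.

Lemma le_ordW i j : (i <= j)%N -> le_ord j m -> le_ord i m.
Proof. by case: m => //= n; apply: leq_trans. Qed.

Lemma hs_map_rel p : hs_rel f p -> hs_map_poly p = 0.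
Proof.
case=> [x y i i0 im|a i i0 im|x y k km].
- rewrite !(rmorphB hs_map_poly).
  rewrite /=.
  rewrite hs_map_gen; last done.
  rewrite hs_map_gen; last done. rewrite hs_map_gen; last done.
  rewrite (rmorphD beta).
  rewrite /hs_d.
  by rewrite -!(rmorphB (hs_pi f' m)); apply: hs_piI; apply: HsAdd.
- by rewrite hs_map_gen // sq; apply: hs_piI; apply: HsBase.
- rewrite (rmorphB hs_map_poly) /= hs_map_gen // (rmorphM beta).
  rewrite (rmorph_sum hs_map_poly) /=.
  rewrite (eq_bigr (fun i : 'I_k.+1 => hs_pi f' m
      (hs_gen m (beta x) i * hs_gen m (beta y) (k - i)))) => [|i _].
    by rewrite /hs_d -(rmorph_sum (hs_pi f' m)) -(rmorphB (hs_pi f' m));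
       apply: hs_piI; apply: HsMul.
  rewrite (rmorphM hs_map_poly) (rmorphM (hs_pi f' m)) /= !hs_map_gen //; first exact: le_ordW (leq_subr _ _) km.
  by apply: le_ordW km; rewrite -ltnS.
Qed.

Lemma hs_map_pi p : hs_map sq (hs_pi f m p) = hs_map_poly p.
Proof. exact: quot_liftE hs_map_rel p. Qed.

Lemma hs_map_zmod_morphism : zmod_morphism (hs_map sq).
Proof.
move=> x y; rewrite -[x]quot_reprK -[y]quot_reprK.
by rewrite -[LHS]/(hs_map sq (hs_pi f m _ - hs_pi f m _)) -(rmorphB (hs_pi f m)) !hs_map_pi
  (rmorphB hs_map_poly).
Qed.

Lemma hs_map_monoid_morphism : monoid_morphism (hs_map sq).
Proof.
split=> [|x y].
  by rewrite -(rmorph1 (hs_pi f m)) hs_map_pi (rmorph1 hs_map_poly).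
rewrite -[x]quot_reprK -[y]quot_reprK.
by rewrite -[LHS]/(hs_map sq (hs_pi f m _ * hs_pi f m _)) -(rmorphM (hs_pi f m)) !hs_map_pi
  (rmorphM hs_map_poly).
Qed.

HB.instance Definition _ := GRing.isZmodMorphism.Build (HS f m) (HS f' m)
  (hs_map sq) hs_map_zmod_morphism.
HB.instance Definition _ := GRing.isMonoidMorphism.Build (HS f m) (HS f' m)
  (hs_map sq) hs_map_monoid_morphism.

Lemma hs_map_d i x : le_ord i m ->
  hs_map sq (hs_d f m i x) = hs_d f' m i (beta x).
Proof. by move=> im; rewrite hs_map_pi hs_map_gen. Qed.

End Functoriality.

(* Commutative, not necessarily unital, C-algebras with a family of           *)
(* homogeneous components; the axioms are stated in graded_nalgebra.          *)
Record nalg_data (C : comPzRingType) := NAlgData {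
  nalg_mod :> lmodType C;
  nalg_mul : nalg_mod -> nalg_mod -> nalg_mod;
  nalg_deg : nat -> nalg_mod -> Prop
}.

Arguments nalg_mul {C} n _ _.
Arguments nalg_deg {C} n _ _.

Section Graded.
Variable C : comPzRingType.
Implicit Types X Y Z : nalg_data C.

Definition nalg_axioms X :=
  [/\ associative (nalg_mul X), commutative (nalg_mul X),
      left_distributive (nalg_mul X) +%R
    & forall (c : C) (x y : X), nalg_mul X (c *: x) y = c *: nalg_mul X x y].

(* X is the internal direct sum of its components.                            *)
Definition direct_decomposition X :=
  (forall x : X, exists k (u : nat -> X),
     (forall i, nalg_deg X i (u i)) /\ x = \sum_(i < k) u i) /\
  (forall k (u : nat -> X), (forall i, nalg_deg X i (u i)) ->
     \sum_(i < k) u i = 0 -> forall i, (i < k)%N -> u i = 0).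

Definition graded_nalgebra X :=
  [/\ nalg_axioms X,
      forall n, [/\ nalg_deg X n 0,
        forall x y, nalg_deg X n x -> nalg_deg X n y -> nalg_deg X n (x + y)
        & forall (c : C) x, nalg_deg X n x -> nalg_deg X n (c *: x)],
      direct_decomposition X
    & forall i j x y, nalg_deg X i x -> nalg_deg X j y ->
        nalg_deg X (i + j) (nalg_mul X x y)].

Definition graded_algebra X (e : X) :=
  [/\ graded_nalgebra X, nalg_deg X 0 e & left_id e (nalg_mul X)].

Definition graded_hom X Y (phi : X -> Y) :=
  [/\ linear phi, {morph phi : x y / nalg_mul X x y >-> nalg_mul Y x y}
    & forall n x, nalg_deg X n x -> nalg_deg Y n (phi x)].

(* 0 -> X -> Y -> Z -> 0                                                      *)
Definition short_exact X Y Z (phi : X -> Y) (psi : Y -> Z) :=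
  [/\ injective phi, (forall y, psi y = 0 <-> exists x, phi x = y)
    & forall z, exists y, psi y = z].

End Graded.

Definition hs_alg (A C : comPzRingType) (f : {rmorphism A -> C})
    (m : option nat) : nalg_data C :=
  @NAlgData C (HS f m) *%R (@hs_deg A C f m).

Section Sequence.
Variables (A B C : comPzRingType).
Variables (f : {rmorphism A -> B}) (g : {rmorphism B -> C}) (m : option nat).

Definition rcomp : {rmorphism A -> C} := g \o f.

Definition hs_natural : HS f m -> HS rcomp m :=
  @hs_map A B A C f rcomp idfun g m (fun=> erefl).
HB.instance Definition _ := GRing.RMorphism.on hs_natural.

Definition hs_proj : HS rcomp m -> HS g m :=
  @hs_map A C B C rcomp g f idfun m (fun=> erefl).
HB.instance Definition _ := GRing.RMorphism.on hs_proj.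

Lemma hs_natural_d i b : le_ord i m ->
  hs_natural (hs_d f m i b) = hs_d rcomp m i (g b).
Proof. exact: hs_map_d. Qed.

Lemma hs_proj_d i c : le_ord i m -> hs_proj (hs_d rcomp m i c) = hs_d g m i c.
Proof. exact: hs_map_d. Qed.

(* The ideal of HS rcomp m generated by the image of (HS f m)^+.              *)
Definition hs_plus_ext : {pred HS rcomp m} :=
  gen_ideal (fun h => exists2 u : HS f m, hs_plus f m u & h = hs_natural u).
HB.instance Definition _ := GRing.ZmodClosed.on hs_plus_ext.

Lemma hs_plus_ext_scaler_closed : scaler_closed hs_plus_ext.
Proof. by move=> c h; apply: gen_idealMl. Qed.

HB.instance Definition _ := GRing.isScaleClosed.Build C (HS rcomp m) hs_plus_ext
  hs_plus_ext_scaler_closed.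

Record hs_plus_ext_type :=
  HsPlusExt { hs_incl : HS rcomp m; hs_inclP : hs_incl \in hs_plus_ext }.

HB.instance Definition _ := [isSub for hs_incl].
HB.instance Definition _ := [Choice of hs_plus_ext_type by <:].
HB.instance Definition _ := [SubChoice_isSubZmodule of hs_plus_ext_type by <:].
HB.instance Definition _ :=
  [SubZmodule_isSubLmodule of hs_plus_ext_type by <:].

Definition hs_plus_ext_mul (x y : hs_plus_ext_type) : hs_plus_ext_type :=
  HsPlusExt (gen_idealMl (hs_incl x) (hs_inclP y)).

Definition hs_plus_ext_alg : nalg_data C :=
  @NAlgData C hs_plus_ext_type hs_plus_ext_mul
    (fun n x => hs_deg n (hs_incl x)).

End Sequence.

Arguments rcomp {A B C} f g.
Arguments hs_natural {A B C} f g m _.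
Arguments hs_proj {A B C} f g m _.
Arguments hs_plus_ext {A B C} f g m _.
Arguments hs_incl {A B C} f g m _.

(* Main.v *)
Require Import Defs.
From mathcomp Require Import all_boot all_order all_algebra.
From mathcomp Require Import finmap.
From mathcomp.multinomials Require Import monalg.

Set Implicit Arguments.
Unset Strict Implicit.
Unset Printing Implicit Defensive.

Import GRing.Theory.
Local Open Scope ring_scope.

(** The algebra HS of Hasse-Schmidt derivations is the quotient of a weighted
polynomial algebra by weight-homogeneous relations, so it is graded; the
sequence is exact because the presentations of HS(C/A) and HS(C/B) have the
same generators and differ only by relations of the form d_i (g b) = 0, i > 0.

Gradings are handled through their projections: a family of additive operators
c n that are orthogonal idempotents, sum up finitely to the identity and turn
products into convolutions ([grading_projections]).  An ideal whose generators
have all their components in the ideal is stable under the projections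
([gp_gen_ideal]), hence the projections descend to the quotient ([gp_quot]).
The weight components of polynomials form such a family ([gp_pa_part]) and the
defining relations of HS are homogeneous ([hs_rel_homog]), so HS is graded.  The
ideal I generated by the image of the positive part of HS(B/A) is generated by
homogeneous elements, since the natural map preserves degrees, so I inherits the
grading ([hs_plus_ext_part]).

The projection HS(C/A) -> HS(C/B) sends the class of a polynomial to the class of
the same polynomial ([hs_proj_pi]), which gives surjectivity.  It kills I: the
composite HS(B/A) -> HS(C/A) -> HS(C/B) sends d_i b to d_i (g b) = 0 for i > 0, and
every monomial of positive weight contains such a variable
([hs_map_positive_eq0]).  Conversely a polynomial whose class in HS(C/B) vanishes
is a combination of relations; the additivity and Leibniz relations already
vanish in HS(C/A), and the remaining ones have the image d_i (g b), which is the
image of the element d_i b of positive degree ([hs_proj_eq0]). *)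

(** * Gradings through their projections *)

(** The projections onto the components of a direct sum decomposition of R
indexed by nat, compatible with products.  Unlike the components themselves,
the projections can be computed on representatives of a quotient. *)
Record grading_projections (R : comPzRingType) (c : nat -> R -> R) : Prop :=
  GradingProjections {
    gpD : forall n, {morph c n : x y / x + y};
    gpM : forall n x y, c n (x * y) = \sum_(i < n.+1) c i x * c (n - i)%N y;
    gpK : forall i j x, c i (c j x) = if i == j then c j x else 0;
    gp_sum : forall x, exists k, x = \sum_(i < k) c i x }.

Section GradingProjections.
Variables (R : comPzRingType) (c : nat -> R -> R).
Hypothesis gpc : grading_projections c.

Lemma gp0 n : c n 0 = 0.
Proof. by apply: (addrI (c n 0)); rewrite -(gpD gpc) !addr0. Qed.

Lemma gp_big n I (r : seq I) (F : I -> R) :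
  c n (\sum_(i <- r) F i) = \sum_(i <- r) c n (F i).
Proof. exact: (big_morph (c n) (gpD gpc n) (gp0 n)). Qed.

Lemma gpB n x y : c n (x - y) = c n x - c n y.
Proof.
suff -> : c n x = c n (x - y) + c n y by rewrite addrK.
by rewrite -(gpD gpc) subrK.
Qed.

Lemma gpid n x : c n (c n x) = c n x.
Proof. by rewrite (gpK gpc) eqxx. Qed.

(** Of the convolution, only the term of index i is nonzero. *)
Lemma gp_homogM i j x y :
  c i x = x -> c j y = y -> c (i + j)%N (x * y) = x * y.
Proof.
move=> xi yj; rewrite (gpM gpc).
have i_lt : (i < (i + j).+1)%N by rewrite ltnS leq_addr.
rewrite (bigD1 (Ordinal i_lt)) //= xi addKn yj big1 ?addr0 // => a.
by rewrite -val_eqE /= -xi (gpK gpc) => /negPf ->; rewrite mul0r.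
Qed.

(** The components of a sum of homogeneous elements are its terms: this is the
uniqueness of a homogeneous decomposition. *)
Lemma gp_homog_sum (k : nat) (u : nat -> R) i :
  (forall j, c j (u j) = u j) -> (i < k)%N -> c i (\sum_(j < k) u j) = u i.
Proof.
move=> homu ik; rewrite gp_big (bigD1 (Ordinal ik)) //= homu big1 ?addr0 // => j.
by rewrite -val_eqE /= eq_sym -homu (gpK gpc) => /negPf ->.
Qed.

(** The elements all of whose components lie in the ideal form an ideal, because
projections turn products into convolutions; it contains the generators. *)
Lemma gp_gen_ideal (S : R -> Prop) :
  (forall s n, S s -> c n s \in gen_ideal S) ->
  forall x n, x \in gen_ideal S -> c n x \in gen_ideal S.
Proof.
move=> Sc x n /gen_idealP Ix.
apply: (Ix (fun y => forall k, c k y \in gen_ideal S)) => [|s Ss k]; last exact: Sc.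
split=> [k|y z Iy Iz k|a y Iy k]; first by rewrite gp0 rpred0.
  by rewrite (gpD gpc) rpredD.
by rewrite (gpM gpc) rpred_sum // => i _; apply: gen_idealMl.
Qed.

Section Quotient.
Variable S : R -> Prop.
Hypothesis S_comp : forall s n, S s -> c n s \in gen_ideal S.

Definition quot_part (n : nat) (x : quot_ring S) : quot_ring S :=
  quot_pi S (c n (repr x)).

Lemma quot_part_pi n x : quot_part n (quot_pi S x) = quot_pi S (c n x).
Proof.
apply/quot_piP; set y := repr _.
have /(gp_gen_ideal S_comp n) : y - x \in gen_ideal S.
  by apply/quot_piP; rewrite quot_reprK.
by rewrite gpB.
Qed.

Lemma gp_quot : grading_projections quot_part.
Proof.
split=> [n x y|n x y|i j x|x].
- rewrite -[x]quot_reprK -[y]quot_reprK -(rmorphD (quot_pi S)) !quot_part_pi.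
  by rewrite (gpD gpc) (rmorphD (quot_pi S)).
- rewrite -[x]quot_reprK -[y]quot_reprK -(rmorphM (quot_pi S)) quot_part_pi.
  rewrite (gpM gpc) (rmorph_sum (quot_pi S)); apply: eq_bigr => i _.
  by rewrite (rmorphM (quot_pi S)) /= !quot_part_pi.
- rewrite -[x]quot_reprK !quot_part_pi (gpK gpc).
  by case: (i == j) => //; rewrite (rmorph0 (quot_pi S)).
rewrite -[x]quot_reprK; have [k xE] := gp_sum gpc (repr x); exists k.
rewrite {1}xE (rmorph_sum (quot_pi S)) /=.
by apply: eq_bigr => i _; rewrite quot_part_pi.
Qed.

End Quotient.
End GradingProjections.

(** * The weight grading of a polynomial algebra *)

Section PolyAlg.
Variables (R : comPzRingType) (V : choiceType).
Implicit Types (p : polyalg R V) (k : {cmonom V}).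

Lemma pa_mon_mul (c1 c2 : R) k1 k2 :
  (<< c1 *g k1 >> : polyalg R V) * << c2 *g k2 >> = << c1 * c2 *g mmul k1 k2 >>.
Proof. exact: pa_mulUU. Qed.

Lemma pa_mon_mul1 k1 k2 :
  (<< 1 *g k1 >> : polyalg R V) * << 1 *g k2 >> = << 1 *g mmul k1 k2 >>.
Proof. by rewrite pa_mon_mul mulr1. Qed.

Lemma pa_ind (Q : polyalg R V -> Prop) :
  Q 0 -> (forall p q, Q p -> Q q -> Q (p + q)) ->
  (forall c k, Q << c *g k >>) -> forall p, Q p.
Proof. by move=> Q0 QD Qm p; rewrite [p]monalgE; apply: big_ind => // k _. Qed.

Section Weight.
Variable w : {cmonom V} -> nat.
Hypothesis wM : {morph w : k1 k2 / mmul k1 k2 >-> (k1 + k2)%N}.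

Definition pa_part (n : nat) p : polyalg R V :=
  [malg k in msupp p => if w k == n then p@_k else 0].

Lemma mcoeff_pa_part n p k :
  (pa_part n p)@_k = if w k == n then p@_k else 0.
Proof.
rewrite mcoeffE; case: ifP => // /negbT /mcoeff_outdom ->.
by rewrite if_same.
Qed.

Lemma pa_partU n c k :
  pa_part n << c *g k >> = if w k == n then << c *g k >> else 0.
Proof.
apply/malgP => k'; rewrite mcoeff_pa_part mcoeffU.
have [<-|nk] := eqVneq k k'; first by case: ifP; rewrite ?mcoeffUU ?mcoeff0.
by rewrite if_same; case: ifP; rewrite ?mcoeff0 // mcoeffU (negPf nk).
Qed.

Lemma pa_partD n : {morph pa_part n : p q / p + q}.
Proof.
move=> p q; apply/malgP => k; rewrite mcoeffD !mcoeff_pa_part mcoeffD.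
by case: ifP; rewrite ?addr0.
Qed.

Lemma pa_part0 n : pa_part n 0 = 0.
Proof. by apply/malgP => k; rewrite mcoeff_pa_part mcoeff0 if_same. Qed.

(** Both sides are biadditive, so it suffices to compare them on monomials, where
additivity of the weight leaves a single term in the convolution. *)
Lemma pa_partM n p q :
  pa_part n (p * q) = \sum_(i < n.+1) pa_part i p * pa_part (n - i)%N q.
Proof.
move: p q; apply: pa_ind => [q|p1 p2 IH1 IH2 q|a k].
- rewrite mul0r pa_part0 big1 // => i _; by rewrite pa_part0 mul0r.
- rewrite mulrDl pa_partD IH1 IH2 -big_split; apply: eq_bigr => i _ /=.
  by rewrite pa_partD mulrDl.
apply: pa_ind => [|q1 q2 IH1 IH2|b l].
- rewrite mulr0 pa_part0 big1 // => i _; by rewrite pa_part0 mulr0.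
- rewrite mulrDr pa_partD IH1 IH2 -big_split; apply: eq_bigr => i _ /=.
  by rewrite pa_partD mulrDr.
rewrite pa_mon_mul pa_partU wM.
have [kn|nk] := leqP (w k) n; last first.
  rewrite big1 => [|i _].
    by rewrite gtn_eqF // ltn_addr.
  by rewrite pa_partU gtn_eqF ?mul0r // (leq_ltn_trans _ nk) // -ltnS.
rewrite -ltnS in kn; rewrite (bigD1 (Ordinal kn)) //= !pa_partU eqxx.
rewrite big1 => [|i]; last first.
  by rewrite -val_eqE eq_sym pa_partU => /negPf ->; rewrite mul0r.
rewrite addr0 -(eqn_add2l (w k) (w l)) subnKC //.
by case: (w k + w l == n)%N; [rewrite pa_mon_mul | rewrite mulr0].
Qed.

Lemma pa_partK i j p :
  pa_part i (pa_part j p) = if i == j then pa_part j p else 0.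
Proof.
apply/malgP => k; rewrite !mcoeff_pa_part.
have [<-|ij] := eqVneq i j; first by rewrite mcoeff_pa_part; case: (w k == i).
by rewrite mcoeff0; have [->|//] := eqVneq (w k) i; rewrite (negPf ij).
Qed.

Lemma pa_part_sum p : exists n, p = \sum_(i < n) pa_part i p.
Proof.
exists (\max_(k <- msupp p) w k).+1; apply/malgP => k.
rewrite (raddf_sum (mcoeff k)) /=.
under eq_bigr do rewrite mcoeff_pa_part.
have [kp|/mcoeff_outdom ->] := boolP (k \in msupp p); last first.
  by rewrite big1 // => i _; rewrite if_same.
have wk : (w k < (\max_(k <- msupp p) w k).+1)%N.
  by rewrite ltnS; apply: leq_bigmax_seq.
rewrite (bigD1 (Ordinal wk)) //= eqxx big1 ?addr0 // => i.
by rewrite -val_eqE /= eq_sym => /negPf ->.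
Qed.

Lemma gp_pa_part : grading_projections pa_part.
Proof.
split; [exact: pa_partD | exact: pa_partM | exact: pa_partK | exact: pa_part_sum].
Qed.

Lemma pa_part_homog n p :
  (forall k, k \in msupp p -> w k = n) <-> pa_part n p = p.
Proof.
split=> [pn|<- k].
  apply/malgP => k; rewrite mcoeff_pa_part.
  by case: (boolP (k \in msupp p)) => [/pn -> | /mcoeff_outdom ->];
     rewrite ?eqxx ?if_same.
by rewrite -mcoeff_neq0 mcoeff_pa_part; case: (w k =P n); rewrite ?eqxx.
Qed.

End Weight.

End PolyAlg.

(** * Evaluation of polynomials *)

Section PolyAlgEval.
Variables (R S : comPzRingType) (V : choiceType).

(** A product of powers of variables is a monomial; it is described by its
exponents, so that it can be identified by comparing exponents. *)
Lemma pa_prod_var (s : seq V) (n : V -> nat) :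
  exists2 k : {cmonom V},
    \prod_(v <- s) pa_var R v ^+ n v = << 1 *g k >> :> polyalg R V
    & forall u, k u = (\sum_(v <- s) (v == u) * n v)%N.
Proof.
elim: s => [|v s [k sE kE]].
  by exists mone => [|u]; rewrite big_nil ?cm1.
have [l lE lu] : exists2 l : {cmonom V},
    pa_var R v ^+ n v = << 1 *g l >> :> polyalg R V
    & forall u, l u = ((v == u) * n v)%N.
  elim: (n v) => [|a [l lE lu]].
    by exists mone => [|u]; [exact: expr0 | rewrite cm1 muln0].
  exists (mmul (ucm v) l) => [|u]; last by rewrite cmM cmU lu mulnS.
  rewrite exprS lE pa_var.unlock; exact: pa_mon_mul1.
exists (mmul l k) => [|u]; last by rewrite cmM big_cons lu kE.
rewrite big_cons sE lE; exact: pa_mon_mul1.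
Qed.

Lemma pa_monE (c : R) (k : {cmonom V}) :
  << c *g k >> = pa_const V c * pa_mev (pa_var R) k :> polyalg R V.
Proof.
rewrite /pa_mev; have [l -> lE] := pa_prod_var (finsupp k) k.
suff -> : l = k by rewrite pa_const.unlock pa_mon_mul mul1m mulr1.
apply/eqP/cmP => u; rewrite lE.
have [uk|] := boolP (u \in finsupp k); last first.
  move=> uk; rewrite big1_seq => [|v /andP [_ vk]].
    by apply/eqP; rewrite eq_sym cmE_eq0.
  by case: eqP => // vu; rewrite -vu vk in uk.
rewrite (big_rem u) //= eqxx mul1n big1_seq ?addn0 // => v /andP [_].
by rewrite mem_rem_uniq ?fset_uniq // inE => /andP [/negPf ->].
Qed.

Lemma pa_morph_ext (phi psi : {rmorphism polyalg R V -> S}) :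
  (forall c, phi (pa_const V c) = psi (pa_const V c)) ->
  (forall v, phi (pa_var R v) = psi (pa_var R v)) -> phi =1 psi.
Proof.
move=> eqc eqv; apply: pa_ind => [|p q IHp IHq|c k].
- by rewrite !rmorph0.
- by rewrite !rmorphD IHp IHq.
rewrite pa_monE !rmorphM eqc /pa_mev !rmorph_prod; congr (_ * _).
by apply: eq_bigr => v _; rewrite !rmorphXn eqv.
Qed.

(** Substituting homogeneous elements of degree d v for the variables v sends a
monomial to an element whose degree is its weight. *)
Lemma pa_mev_homog (c : nat -> S -> S) (h : V -> S) (d : V -> nat)
    (k : {cmonom V}) :
  grading_projections c -> c 0%N 1 = 1 -> (forall v, c (d v) (h v) = h v) ->
  c (\sum_(v <- finsupp k) k v * d v)%N (pa_mev h k) = pa_mev h k.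
Proof.
move=> gpc c1 hd; rewrite /pa_mev.
apply: (big_ind2 (fun n (x : S) => c n x = x)) => // [n x n' y nx ny|v _].
  exact: gp_homogM.
elim: (k v) => [|a IHa] //; rewrite mulSn exprS.
exact: gp_homogM.
Qed.

End PolyAlgEval.

(** * The grading of the Hasse-Schmidt algebra *)

Section HasseSchmidtGrading.
Variables (A B : comPzRingType) (f : {rmorphism A -> B}) (m : option nat).
Local Notation V := (B * hs_index m)%type.

Lemma hs_weightM :
  {morph @hs_weight B m : k1 k2 / mmul k1 k2 >-> (k1 + k2)%N}.
Proof.
have weightEw (k : {cmonom V}) (d : {fset V}) : (finsupp k `<=` d)%fset ->
    hs_weight k = (\sum_(v <- d) k v * val v.2)%N.
  move=> le; rewrite /hs_weight (big_fset_incl _ le) //= => v _.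
  by rewrite -cmE_eq0 => /eqP ->.
move=> k1 k2; rewrite {1}/hs_weight mdomD.
rewrite (weightEw _ _ (fsubsetUl _ (finsupp k2))).
rewrite (weightEw _ _ (fsubsetUr (finsupp k1) _)) -big_split /=.
by apply/eq_bigr=> v _; rewrite cmM mulnDl.
Qed.

Local Notation part := (pa_part (@hs_weight B m)).
Let gp_part := gp_pa_part B hs_weightM.

Lemma hs_gen_var (x : B) (j : hs_index m) :
  hs_gen m x (val j) = pa_var B (x, j).
Proof.
rewrite hs_gen.unlock; case E: (val j) (valP j) => [|i] // _.
by rewrite -E valK.
Qed.

(** For i beyond the order m, [hs_gen m x i] is 0, which has every weight. *)
Lemma part_hs_gen (x : B) i : part i (hs_gen m x i) = hs_gen m x i.
Proof.
rewrite hs_gen.unlock; case: i => [|i].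
  by rewrite pa_const.unlock pa_partU /hs_weight mdom1 big_seq_fset0.
case: insubP => [j _ ji|_]; last exact: (gp0 gp_part).
by rewrite pa_var.unlock pa_partU /hs_weight mdomU big_seq_fset1 cmUU mul1n ji eqxx.
Qed.

Lemma hs_rel_homog (p : hs_poly B m) : hs_rel f p -> exists d, part d p = p.
Proof.
case=> [x y i _ _|a i _ _|x y k _]; [exists i|exists i|exists k].
- by rewrite !(gpB gp_part) !part_hs_gen.
- exact: part_hs_gen.
rewrite (gpB gp_part) part_hs_gen (gp_big gp_part); congr (_ - _).
apply: eq_bigr => i _; have {1}<- : (i + (k - i) = k)%N by rewrite subnKC // -ltnS.
by rewrite (gp_homogM gp_part) ?part_hs_gen.
Qed.

Lemma hs_rel_part (p : hs_poly B m) n :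
  hs_rel f p -> part n p \in gen_ideal (@hs_rel A B f m).
Proof.
move=> rp; have [d pd] := hs_rel_homog rp.
have -> : part n p = if n == d then p else 0 by rewrite -{1}pd (gpK gp_part) pd.
by case: (n == d); [apply: gen_ideal_gen | apply: rpred0].
Qed.

Definition hs_part (n : nat) : HS f m -> HS f m := quot_part part n.

Lemma gp_hs_part : grading_projections hs_part.
Proof. exact: (gp_quot gp_part hs_rel_part). Qed.

Lemma hs_part_pi n (p : hs_poly B m) :
  hs_part n (hs_pi f m p) = hs_pi f m (part n p).
Proof. exact: (quot_part_pi gp_part hs_rel_part). Qed.

(** A fixed element has a homogeneous representative: the component of any of its
representatives. *)
Lemma hs_degP n (h : HS f m) : hs_deg n h <-> hs_part n h = h.
Proof.
split=> [[p /pa_part_homog pn ->]|hn]; first by rewrite hs_part_pi pn.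
exists (part n (repr h)); last by rewrite -hs_part_pi [hs_pi _ _ _]quot_reprK hn.
by apply/pa_part_homog; rewrite (gpid gp_part).
Qed.

Lemma hs_deg_d i (x : B) : hs_deg i (hs_d f m i x).
Proof. by apply/hs_degP; rewrite hs_part_pi part_hs_gen. Qed.

Lemma hs_deg_const (b : B) : hs_deg 0 (hs_const f m b).
Proof.
have -> : hs_const f m b = hs_d f m 0 b by rewrite /hs_d hs_gen.unlock.
exact: hs_deg_d.
Qed.

Lemma hs_degM i j (x y : HS f m) : hs_deg i x -> hs_deg j y -> hs_deg (i + j) (x * y).
Proof.
by move=> /hs_degP xi /hs_degP yj; apply/hs_degP; apply: (gp_homogM gp_hs_part).
Qed.

Lemma hs_deg0 n : hs_deg n (0 : HS f m).
Proof. by apply/hs_degP; apply: gp0 gp_hs_part _. Qed.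

Lemma hs_degD n (x y : HS f m) : hs_deg n x -> hs_deg n y -> hs_deg n (x + y).
Proof.
by move=> /hs_degP xn /hs_degP yn; apply/hs_degP; rewrite (gpD gp_hs_part) xn yn.
Qed.

Lemma hs_degZ n (b : B) (x : HS f m) : hs_deg n x -> hs_deg n (b *: x).
Proof. exact: (hs_degM (hs_deg_const b)). Qed.

Lemma hs_deg1 : hs_deg 0 (1 : HS f m).
Proof. by rewrite -(rmorph1 (hs_const f m)); apply: hs_deg_const. Qed.

Lemma hs_plus_deg i (x : HS f m) : hs_deg i.+1 x -> hs_plus f m x.
Proof.
move=> xi; exists i.+1, (fun j => if j == i then x else 0); split.
  by move=> j; case: eqP => [->|_] //; apply: hs_deg0.
by rewrite big_ord_recr /= eqxx big1 ?add0r // => j _; rewrite ltn_eqF.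
Qed.

Lemma hs_graded : graded_algebra (X := hs_alg f m) (1 : HS f m).
Proof.
split; [split|exact: hs_deg1|exact: mul1r].
- split; [exact: mulrA|exact: mulrC|exact: mulrDl|].
  by move=> c x y; rewrite /= /GRing.scale /= /hs_scale mulrA.
- by move=> n; split; [exact: hs_deg0|exact: hs_degD|exact: hs_degZ].
- split=> [x|k u homu sum0 i ik].
    have [k xE] := gp_sum gp_hs_part x; exists k, (hs_part^~ x); split=> // i.
    by apply/hs_degP/(gpid gp_hs_part).
  have partu j : hs_part j (u j) = u j by apply/hs_degP/homu.
  rewrite -(gp_homog_sum gp_hs_part partu ik) [X in hs_part _ X]sum0.
  exact: (gp0 gp_hs_part).
- exact: hs_degM.
Qed.

End HasseSchmidtGrading.

(** * Functoriality in positive degree *)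

Section Functoriality.
Variables (A B A' B' : comPzRingType).
Variables (f : {rmorphism A -> B}) (f' : {rmorphism A' -> B'}).
Variables (alpha : {rmorphism A -> A'}) (beta : {rmorphism B -> B'}).
Hypothesis sq : forall a, beta (f a) = f' (alpha a).
Variable m : option nat.

Lemma hs_map_deg n (x : HS f m) : hs_deg n x -> hs_deg n (hs_map sq x).
Proof.
case=> p pn ->; rewrite hs_map_pi /hs_map_poly pa_evalE big_seq.
apply: big_ind => [|y z|k /pn <-]; [exact: hs_deg0|exact: hs_degD|].
apply: (hs_degM (hs_deg_const _ _ _)); apply/hs_degP.
apply: (pa_mev_homog (d := fun v : B * hs_index m => val v.2)) => [||v].
- exact: gp_hs_part.
- exact/hs_degP/hs_deg1.
- exact/hs_degP/hs_deg_d.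
Qed.

(** Each variable x^(i) is sent to d_i (f' a) = 0 for some a, and a monomial of
positive weight contains a variable. *)
Lemma hs_map_positive_eq0 (beta_im : forall b, exists a, beta b = f' a) n (x : HS f m) :
  hs_deg n.+1 x -> hs_map sq x = 0.
Proof.
case=> p pn ->; rewrite hs_map_pi /hs_map_poly pa_evalE big_seq big1 // => k /pn wk.
suff [v vk] : exists v, v \in finsupp k.
  rewrite /pa_mev (big_rem v) //=; move: vk; rewrite -cmE_neq0.
  case: (k v) => // a _; have [a' ->] := beta_im v.1; rewrite exprS.
  have -> : hs_d f' m (val v.2) (f' a') = 0.
    by case/andP: (valP v.2) => v0 vm; apply: hs_piI; apply: HsBase.
  by rewrite !mul0r mulr0.
case: (fset_0Vmem (finsupp k)) => [k0|[v vk]]; last by exists v.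
by move: wk; rewrite /hs_weight k0 big_seq_fset0.
Qed.

End Functoriality.

(** * The exact sequence *)

Section Sequence.
Variables (A B C : comPzRingType).
Variables (f : {rmorphism A -> B}) (g : {rmorphism B -> C}) (m : option nat).

Lemma hs_proj_pi (p : hs_poly C m) :
  hs_proj f g m (hs_pi (rcomp f g) m p) = hs_pi g m p.
Proof.
rewrite /hs_proj hs_map_pi; apply: pa_morph_ext p => [c|[x j]].
  exact: pa_eval_const.
by apply: etrans (pa_eval_var _ _ _) _; rewrite /hs_d hs_gen_var.
Qed.

Lemma hs_proj_const c :
  hs_proj f g m (hs_const (rcomp f g) m c) = hs_const g m c.
Proof. exact: hs_proj_pi. Qed.

Lemma hs_proj_linear : linear (hs_proj f g m).
Proof.
move=> c x y; rewrite (rmorphD (hs_proj f g m)); congr (_ + _).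
rewrite -[c *: x]/(hs_const (rcomp f g) m c * x) (rmorphM (hs_proj f g m)) /=.
by rewrite hs_proj_const.
Qed.

Lemma hs_natural_deg n u :
  hs_deg n u -> hs_deg n (hs_natural f g m u).
Proof. exact: hs_map_deg. Qed.

Lemma hs_proj_natural (u : HS f m) :
  hs_proj f g m (hs_natural f g m u)
  = @hs_map A B B C f g f g m (fun=> erefl) u.
Proof.
rewrite -[u]quot_reprK -/(hs_pi f m _) /hs_natural !hs_map_pi.
pose phi : {rmorphism hs_poly B m -> HS g m} :=
  hs_proj f g m \o @hs_map_poly B A C (rcomp f g) g m.
apply: (pa_morph_ext (phi := phi)) => [c|[x j]].
  rewrite /phi /= /hs_map_poly !pa_eval_const; exact: hs_proj_const.
rewrite /phi /= /hs_map_poly !pa_eval_var; apply: hs_proj_d.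
by case/andP: (valP j).
Qed.

(** The composite of the two maps is the map attached to the square with sides f
and g, all of whose elements g b come from the base ring B of HS(C/B). *)
Lemma hs_proj_natural_plus n (u : HS f m) :
  hs_deg n.+1 u -> hs_proj f g m (hs_natural f g m u) = 0.
Proof. by rewrite hs_proj_natural; apply: hs_map_positive_eq0 => b; exists b. Qed.

Lemma hs_natural_plus_ext n (u : HS f m) :
  hs_deg n.+1 u -> hs_natural f g m u \in hs_plus_ext f g m.
Proof.
by move=> un; apply: gen_ideal_gen; exists u => //; apply: hs_plus_deg un.
Qed.

(** The generators of the ideal are sums of images of homogeneous elements of
positive degree, and each of these images is homogeneous and in the ideal. *)
Lemma hs_plus_ext_part n (x : HS (rcomp f g) m) :
  x \in hs_plus_ext f g m -> hs_part n x \in hs_plus_ext f g m.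
Proof.
apply: (gp_gen_ideal (gp_hs_part _ _)) => _ {}n [_ [k [u [homu ->]]] ->].
rewrite (rmorph_sum (hs_natural f g m)) (gp_big (gp_hs_part _ _)).
apply: rpred_sum => i _ /=; have /hs_natural_deg/hs_degP hi := homu i.
rewrite -hi (gpK (gp_hs_part _ _)) hi; case: (n == _); last exact: rpred0.
exact: (hs_natural_plus_ext (homu i)).
Qed.

(** For the inclusion of the kernel in the ideal, the preimage of the ideal in the
polynomial algebra is an ideal, and it contains the relations of HS(C/B): those
of additivity and Leibniz type are also relations of HS(C/A), and the class of
(g b)^(i) is the image of d_i b. *)
Lemma hs_proj_eq0 (x : HS (rcomp f g) m) :
  hs_proj f g m x = 0 <-> x \in hs_plus_ext f g m.
Proof.
split=> [|/gen_idealP Ix]; last first.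
  apply: (Ix (fun y => hs_proj f g m y = 0)) => [|_ [_ [k [u [homu ->]]] ->]].
    split=> [|y z y0 z0|a y y0]; first exact: (rmorph0 (hs_proj f g m)).
      by rewrite (rmorphD (hs_proj f g m)) /= y0 z0 addr0.
    by rewrite (rmorphM (hs_proj f g m)) /= y0 mulr0.
  rewrite (rmorph_sum (hs_natural f g m)) (rmorph_sum (hs_proj f g m)).
  by rewrite big1 // => i _; apply: hs_proj_natural_plus (homu i).
rewrite -[x]quot_reprK -/(hs_pi (rcomp f g) m _) hs_proj_pi.
move: (repr x) => p p0.
have /gen_idealP Ip : p \in gen_ideal (@hs_rel B C g m).
  by rewrite -[p]subr0; apply/quot_piP; rewrite (rmorph0 (quot_pi _)).
apply: (Ip (fun q => hs_pi (rcomp f g) m q \in hs_plus_ext f g m)) => [|q].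
  split=> [|q r Iq Ir|a q Iq].
  - by rewrite (rmorph0 (hs_pi (rcomp f g) m)) rpred0.
  - by rewrite (rmorphD (hs_pi (rcomp f g) m)) rpredD.
  - by rewrite (rmorphM (hs_pi (rcomp f g) m)); apply: gen_idealMl.
case=> [y z i i0 im|b i i0 im|y z k km].
- by rewrite hs_piI ?rpred0 //; apply: HsAdd.
- rewrite -/(hs_d (rcomp f g) m i (g b)) -hs_natural_d //.
  by case: i i0 im => // i _ _; apply: hs_natural_plus_ext; apply: hs_deg_d.
- by rewrite hs_piI ?rpred0 //; apply: HsMul.
Qed.

Local Notation I := (hs_plus_ext_alg f g m).

Lemma hs_incl_inj : injective (hs_incl f g m).
Proof. exact: val_inj. Qed.

Lemma hs_incl_sum k (u : nat -> I) :
  hs_incl f g m (\sum_(i < k) u i) = \sum_(i < k) hs_incl f g m (u i).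
Proof. exact: (big_morph (hs_incl f g m)). Qed.

Lemma hs_plus_ext_graded : graded_nalgebra I.
Proof.
have [[[_ _ _ _] degP [_ dir] degM] _ _] := hs_graded (rcomp f g) m.
split.
- split=> [x y z|x y|x y z|c x y]; apply: hs_incl_inj.
  + exact: mulrA.
  + exact: mulrC.
  + exact: mulrDl.
  + exact/esym/mulrA.
- move=> n; have [deg0 degD degZ] := degP n; split=> [|x y|c x].
  + exact: deg0.
  + exact: degD.
  + exact: degZ.
- split=> [x|k u homu sum0 i ik].
    pose u i : I := HsPlusExt (hs_plus_ext_part i (hs_inclP x)).
    have [k xE] := gp_sum (gp_hs_part (rcomp f g) m) (hs_incl f g m x).
    exists k, u; split=> [i|].
      by apply/hs_degP/(gpid (gp_hs_part _ _)).
    by apply: hs_incl_inj; rewrite hs_incl_sum.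
  apply: hs_incl_inj; apply: (dir k (fun j => hs_incl f g m (u j))) ik => //.
  by rewrite -hs_incl_sum sum0.
- by move=> i j x y; apply: degM.
Qed.

End Sequence.

Theorem theorem2p1 (A B C : comPzRingType)
    (f : {rmorphism A -> B}) (g : {rmorphism B -> C}) (m : option nat) :
  [/\ graded_nalgebra (hs_plus_ext_alg f g m),
      graded_algebra (X := hs_alg (rcomp f g) m) (1 : HS (rcomp f g) m)
    & graded_algebra (X := hs_alg g m) (1 : HS g m)] /\
  [/\ graded_hom (X := hs_plus_ext_alg f g m) (Y := hs_alg (rcomp f g) m)
        (hs_incl f g m),
      graded_hom (X := hs_alg (rcomp f g) m) (Y := hs_alg g m)
        (hs_proj f g m)
    & hs_proj f g m 1 = 1] /\
  short_exact (X := hs_plus_ext_alg f g m) (Y := hs_alg (rcomp f g) m)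
    (Z := hs_alg g m) (hs_incl f g m) (hs_proj f g m).
Proof.
split; first by split; [exact: hs_plus_ext_graded|exact: hs_graded|exact: hs_graded].
split.
  split; last exact: (rmorph1 (hs_proj f g m)).
  - by split.
  - split; [exact: hs_proj_linear|exact: (rmorphM (hs_proj f g m))|].
    by move=> n x; apply: hs_map_deg.
split; first exact: hs_incl_inj.
  move=> y; split=> [/hs_proj_eq0 yI|[x <-]]; first by exists (HsPlusExt yI).
  exact/hs_proj_eq0/hs_inclP.
move=> z; exists (hs_pi (rcomp f g) m (repr z)).
by rewrite [LHS]hs_proj_pi; apply: quot_reprK.
Qed.
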